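(* Let $m\ge 2$, let $D\subsetneq\mathbb{R}^m$ be a domain, let $d_D$ be the signed distance function to $\partial D$, and let $p\in\partial D$. If $d_D$ is differentiable at every point of an open neighborhood $U$ of $p$, then $d_D\in\mathcal{C}^{1,1}(U)$.
   Context: $|\cdot|$ is the Euclidean norm on $\mathbb{R}^m$. A domain is a nonempty connected open set. Set $\delta_D(x):=\min_{y\in\partial D}|x-y|$; the signed distance function $d_D:\mathbb{R}^m\to\mathbb{R}$ is defined by $d_D:=\delta_D$ on $D$ and $d_D:=-\delta_D$ on $\mathbb{R}^m\setminus D$. For an open set $U$, $\mathcal{C}^{1,1}(U)$ denotes the functions that are differentiable on $U$ with locally Lipschitz gradient. Differentiability means (total, Fréchet) differentiability; no continuity of the gradient is assumed in the hypothesis. *)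

(* Defs.v *)
From HB Require Import structures.
From mathcomp Require Export all_boot all_order all_algebra.
From mathcomp Require Export all_classical all_reals all_analysis.

Set Implicit Arguments.
Unset Strict Implicit.
Unset Printing Implicit Defensive.

Import Order.TTheory GRing.Theory Num.Theory.
Import numFieldNormedType.Exports.

Local Open Scope classical_set_scope.
Local Open Scope ring_scope.

(* R^m is 'rV[R]_m. Its library norm is the sup norm, which is equivalent to   *)
(* the Euclidean one: open, closure, connected and differentiable are those of *)
(* the Euclidean space. Metric quantities use the Euclidean norm enorm.        *)
Definition enorm (R : realType) (m : nat) (x : 'rV[R]_m) : R :=
  Num.sqrt (\sum_(i < m) x ord0 i ^+ 2).

Definition boundary (T : topologicalType) (A : set T) : set T :=
  closure A `\` A°.

Definition is_domain (T : topologicalType) (D : set T) : Prop :=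
  [/\ D !=set0, open D & connected D].

(* When the boundary is nonempty (e.g. D is a proper domain) this infimum is   *)
(* attained, the boundary being closed; the value for an empty boundary is     *)
(* the junk value inf set0 = 0.                                                *)
Definition boundary_dist (R : realType) (m : nat) (D : set 'rV[R]_m)
    (x : 'rV[R]_m) : R :=
  inf [set enorm (x - y) | y in boundary D].

Definition signed_dist (R : realType) (m : nat) (D : set 'rV[R]_m)
    (x : 'rV[R]_m) : R :=
  if x \in D then boundary_dist D x else - boundary_dist D x.

Definition gradient (R : realType) (m : nat) (f : 'rV[R]_m -> R)
    (x : 'rV[R]_m) : 'rV[R]_m :=
  \row_(i < m) 'D_(delta_mx ord0 i) f x.

Definition locally_lipschitz_on (R : realType) (m n : nat)
    (U : set 'rV[R]_m) (g : 'rV[R]_m -> 'rV[R]_n) : Prop :=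
  forall x, U x -> exists V : set 'rV[R]_m, exists L : R,
    [/\ nbhs x V, V `<=` U &
        forall y z, V y -> V z -> enorm (g y - g z) <= L * enorm (y - z)].

Definition C11_on (R : realType) (m : nat) (U : set 'rV[R]_m)
    (f : 'rV[R]_m -> R) : Prop :=
  (forall x, U x -> differentiable f x) /\ locally_lipschitz_on U (gradient f).

(* Main.v *)
Require Import Defs.
From mathcomp Require Import lra.

Set Implicit Arguments.
Unset Strict Implicit.
Unset Printing Implicit Defensive.

Import Order.TTheory GRing.Theory Num.Theory.
Import numFieldNormedType.Exports.
Local Open Scope classical_set_scope.
Local Open Scope ring_scope.

(** Write d for the signed distance. Two facts are used about it: d is
1-Lipschitz (a segment leaving D crosses the boundary, [signed_dist_lipschitz1]),
and at each point x of U some unit direction u has 'D_u d x >= 1, that is,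
the gradient has norm 1 ([steep_signed_dist]).

Off the boundary the second fact comes from a nearest boundary point y: d is
affine with slope 1 on the segment between x and y, being 1-Lipschitz with
d x = +/- |x - y| and d y = 0. At a boundary point p nothing a priori excludes a
zero gradient, and the remedy is the climbing lemma [climb]: a 1-Lipschitz
function which is steep at every point of the ball of radius s around x that
is at least as high as x satisfies f c = f x + s for some c at distance s. The
proof is the one-line form of Ekeland's principle: a maximiser of
f z - (1 - q) |z - x| on the ball cannot be interior, since the slope there
would be at most 1 - q. Applied at points x of D close to p (where d > 0, so that
only points off the boundary are met) with a radius almost independent of x,
it yields in the limit a point c with d c = d p + |c - p|, hence slope 1 at p.

Once d is steep on all of U, climbing d and climbing - d from a point x give,
for every closed ball of radius r around x in U, a unit vector v with
d (x + r v) = d x + r and d (x - r v) = d x - r ([two_sided_ray]), and v must be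
the gradient ([gradient_ray]). Comparing the top of the ray through x with the
bottom of the ray through y and vice versa, the parallelogram identity gives
|v_x - v_y| <= |x - y| / r ([ray_directions_lipschitz]). *)

(** * Euclidean norm on row vectors *)

Definition dot (R : realType) (m : nat) (u v : 'rV[R]_m) : R :=
  \sum_(i < m) u ord0 i * v ord0 i.

Section Euclidean.
Variables (R : realType) (m : nat).
Implicit Types (u v w x y z : 'rV[R]_m) (a : R).

Lemma dotC u v : dot u v = dot v u.
Proof. by apply: eq_bigr => i _; rewrite mulrC. Qed.

Lemma dotDl u v w : dot (u + v) w = dot u w + dot v w.
Proof. by rewrite /dot -big_split; apply: eq_bigr => i _; rewrite mxE mulrDl. Qed.

Lemma dotZl a u v : dot (a *: u) v = a * dot u v.
Proof. by rewrite /dot mulr_sumr; apply: eq_bigr => i _; rewrite mxE mulrA. Qed.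

Lemma dotDr u v w : dot w (u + v) = dot w u + dot w v.
Proof. by rewrite dotC dotDl !(dotC w). Qed.

Lemma dotZr a u v : dot u (a *: v) = a * dot u v.
Proof. by rewrite dotC dotZl dotC. Qed.

Lemma dotNl u v : dot (- u) v = - dot u v.
Proof. by rewrite -scaleN1r dotZl mulN1r. Qed.

Lemma dotNr u v : dot u (- v) = - dot u v.
Proof. by rewrite dotC dotNl dotC. Qed.

Definition dotE := (dotDl, dotDr, dotNl, dotNr, dotZl, dotZr).

Lemma dot_ge0 u : 0 <= dot u u.
Proof. by apply: sumr_ge0 => i _; rewrite -expr2 sqr_ge0. Qed.

Lemma sqr_enorm u : enorm u ^+ 2 = dot u u.
Proof.
by rewrite sqr_sqrtr; [exact: eq_bigr|apply: sumr_ge0 => i _; exact: sqr_ge0].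
Qed.

Lemma enorm_ge0 u : 0 <= enorm u.
Proof. exact: sqrtr_ge0. Qed.

Lemma coord_le_enorm u i : `|u ord0 i| <= enorm u.
Proof.
rewrite -sqrtr_sqr ler_wsqrtr // (bigD1 i) //= lerDl.
by apply: sumr_ge0 => j _; rewrite sqr_ge0.
Qed.

Lemma enorm0_eq0 u : enorm u = 0 -> u = 0.
Proof.
move=> u0; apply/rowP => i; rewrite mxE; apply/eqP; rewrite -normr_eq0 eq_le.
by rewrite normr_ge0 -u0 coord_le_enorm.
Qed.

Lemma enormZ a u : enorm (a *: u) = `|a| * enorm u.
Proof.
apply/(pexpIrn (n := 2)) => //; rewrite ?nnegrE ?mulr_ge0 ?enorm_ge0 //.
by rewrite exprMn !sqr_enorm !dotE mulrA -expr2 real_normK ?num_real.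
Qed.

Lemma enormN u : enorm (- u) = enorm u.
Proof. by rewrite -scaleN1r enormZ normrN normr1 mul1r. Qed.

Lemma enormC u v : enorm (u - v) = enorm (v - u).
Proof. by rewrite -enormN opprB. Qed.

Lemma enorm0 : enorm (0 : 'rV[R]_m) = 0.
Proof. by rewrite -(scale0r 0) enormZ normr0 mul0r. Qed.

(** Cauchy-Schwarz, from the nonnegativity of the square of |v| u - |u| v. *)
Lemma dot_le u v : dot u v <= enorm u * enorm v.
Proof.
have [/eqP|] := eqVneq (enorm u * enorm v) 0.
  rewrite mulf_eq0 => /orP[] /eqP /enorm0_eq0 ->.
    by rewrite -(scale0r 0) dotZl mul0r mulr_ge0 ?enorm_ge0.
  by rewrite -(scale0r 0) dotZr mul0r mulr_ge0 ?enorm_ge0.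
have := mulr_ge0 (enorm_ge0 u) (enorm_ge0 v); rewrite le_eqVlt eq_sym.
move=> /orP[->//|uv0 _].
have := dot_ge0 (enorm v *: u - enorm u *: v).
rewrite !dotE -!sqr_enorm (dotC v u) => h.
by rewrite -(ler_pM2l uv0); lra.
Qed.

Lemma enormD u v : enorm (u + v) <= enorm u + enorm v.
Proof.
rewrite -(ler_pXn2r (n := 2)) ?nnegrE ?addr_ge0 ?enorm_ge0 //.
rewrite sqr_enorm sqrrD !sqr_enorm !dotE (dotC v u) mulr2n.
have := dot_le u v; lra.
Qed.

Lemma enorm_tri y x z : enorm (x - z) <= enorm (x - y) + enorm (y - z).
Proof. by rewrite -[x in enorm (x - z)](subrK y) -addrA enormD. Qed.

(** With [norm_le_enorm], this makes the Euclidean norm and the sup norm, which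
defines the topology, equivalent. *)
Lemma enorm_le_norm u : enorm u <= m%:R * `|u|.
Proof.
have -> : m%:R * `|u| = \sum_(i < m) `|u|.
  by rewrite sumr_const card_ord mulr_natl.
rewrite -(ler_pXn2r (n := 2)) ?nnegrE ?enorm_ge0 ?sumr_ge0 //.
have hc i : `|u ord0 i| <= `|u|.
  rewrite [leRHS]mx_normrE.
  exact: (le_bigmax _ (fun ij : 'I_1 * 'I_m => `|u ij.1 ij.2|) (ord0, i)).
rewrite sqr_enorm /dot expr2 mulr_suml; apply: ler_sum => i _.
rewrite -expr2 -real_normK ?num_real // expr2; apply: ler_pM => //.
rewrite (bigD1 i) //= (le_trans (hc i)) // lerDl; exact: sumr_ge0.
Qed.

Lemma norm_le_enorm u : `|u| <= enorm u.
Proof.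
rewrite [leLHS]mx_normrE; apply/bigmax_leP; split; first exact: enorm_ge0.
by move=> [i j] _ /=; rewrite ord1 coord_le_enorm.
Qed.

Lemma nbhs_eball x (A : set 'rV[R]_m) :
  nbhs x A <-> exists2 e, 0 < e & forall y, enorm (y - x) <= e -> A y.
Proof.
split=> [/nbhs_ballP[e /= e0 eA]|[e e0 eA]].
  exists (e / 2); first by rewrite divr_gt0.
  move=> y ye; apply: eA; rewrite -ball_normE /ball_ /= -normrN opprB.
  rewrite (le_lt_trans (norm_le_enorm _)) // (le_lt_trans ye) //.
  by rewrite gtr_pMr // invf_lt1 // ltr1n.
(* The factor is m + 1 rather than m so as to stay positive when m = 0. *)
apply/nbhs_ballP; have m0 : 0 < m.+1%:R :> R by rewrite ltr0n.
exists (e / m.+1%:R) => /=; first by rewrite divr_gt0.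
move=> y; rewrite -ball_normE /ball_ /= -normrN opprB ltr_pdivlMr // => ye.
apply: eA; rewrite (le_trans (enorm_le_norm _)) // ltW // (le_lt_trans _ ye) //.
by rewrite mulrC ler_wpM2l // ler_nat.
Qed.

(** One-sided form, with no absolute value: exchanging x and y gives the other
side. *)
Definition lipschitz1 (f : 'rV[R]_m -> R) :=
  forall x y, f x - f y <= enorm (x - y).

Lemma lipschitz1N f : lipschitz1 f -> lipschitz1 (fun x => - f x).
Proof. by move=> fL x y; rewrite opprK addrC enormC. Qed.

Lemma lipschitz1_continuous f : lipschitz1 f -> continuous f.
Proof.
move=> fL x; apply/(@cvgrPdist_le _ _ _ (nbhs x)) => e e0; apply/nbhs_eball; exists e => // y ye.
by rewrite ler_norml lerNl opprB (le_trans (fL _ _) ye) (le_trans (fL _ _)) // enormC.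
Qed.

Lemma lipschitz1_enorm x : lipschitz1 (fun y => enorm (y - x)).
Proof. by move=> y z; rewrite lerBlDr; exact: enorm_tri. Qed.

Lemma compact_eball x r : compact [set y | enorm (y - x) <= r].
Proof.
apply: bounded_closed_compact.
  exists (enorm x + r); split; first exact: num_real.
  move=> M /ltW xrM y /= yr; apply: le_trans xrM.
  rewrite (le_trans (norm_le_enorm _)) // -[y](subrK x) addrC.
  by rewrite (le_trans (enormD _ _)) // lerD2l.
apply: (@closed_comp _ _ (fun y => enorm (y - x)) [set t | t <= r]).
  by move=> y _; apply: lipschitz1_continuous; exact: lipschitz1_enorm.
exact: closed_le.
Qed.

End Euclidean.

(** * Climbing a steep 1-Lipschitz function *)

Section Climbing.
Variables (R : realType) (m : nat).
Implicit Types (f : 'rV[R]_m -> R) (u v x y z : 'rV[R]_m).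

Lemma derive_le f x u k e : differentiable f x -> 0 < e ->
  (forall h, 0 < h -> h <= e -> f (x + h *: u) - f x <= k * h) ->
  'D_u f x <= k.
Proof.
move=> dfx e0 fk; have fl := @diff_derivable _ _ _ _ _ u dfx.
apply: (cvgr_to_le (F := 0^'+) (f := fun h => h^-1 *: (f (h *: u + x) - f x))).
  exact: cvg_dnbhs_at_right fl.
near=> h; have h0 : 0 < h by [].
rewrite /GRing.scale /= ler_pdivrMl // mulrC (addrC (h *: u)) fk //.
by near: h; exact: nbhs_right_le.
Unshelve. all: by end_near. Qed.

Lemma deriveNv f x u : differentiable f x -> 'D_(- u) f x = - 'D_u f x.
Proof. by move=> dfx; rewrite !deriveE // linearN. Qed.

Lemma derive_opp f x u : differentiable f x ->
  'D_u (fun y => - f y) x = - 'D_u f x.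
Proof. by move=> dfx; rewrite (@deriveN _ _ _ f) //; exact: diff_derivable. Qed.

Lemma derive_gradient f x u : differentiable f x ->
  'D_u f x = dot (gradient f x) u.
Proof.
move=> dfx; rewrite deriveE // [in LHS](row_sum_delta u) linear_sum /=.
by apply: eq_bigr => i _; rewrite linearZ /= mxE deriveE // mulrC.
Qed.

Lemma derive_le_enorm f x u : lipschitz1 f -> differentiable f x ->
  'D_u f x <= enorm u.
Proof.
move=> fL dfx; apply: (derive_le dfx ltr01) => h h0 _.
rewrite (le_trans (fL _ _)) // (addrC x) addrK enormZ gtr0_norm //.
by rewrite mulrC.
Qed.

(** A 1-Lipschitz function that gains r at distance r is affine with slope 1 in
between, which the directional derivative sees. *)
Lemma derive_ray f x u r : lipschitz1 f -> differentiable f x ->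
  0 < r -> enorm u = 1 -> f (x + r *: u) = f x + r -> 1 <= 'D_u f x.
Proof.
move=> fL dfx r0 u1 fr; rewrite -lerN2 -derive_opp //.
have dNf : differentiable (fun y => - f y) x := differentiableN dfx.
apply: (derive_le dNf r0) => h h0 hr.
have := fL (x + r *: u) (x + h *: u).
rewrite opprD addrACA subrr add0r -scalerBl enormZ u1 mulr1 ger0_norm ?subr_ge0 // fr; lra.
Qed.

(** For a differentiable 1-Lipschitz f this says that the gradient of f at x has
norm 1. *)
Definition steep f x := exists2 u, enorm u = 1 & 1 <= 'D_u f x.

Lemma steepN f x : differentiable f x ->
  steep (fun y => - f y) x <-> steep f x.
Proof.
move=> dfx; split=> -[u u1 fu]; exists (- u); rewrite ?enormN //; move: fu.
  by rewrite derive_opp // deriveNv.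
by rewrite derive_opp // deriveNv // opprK.
Qed.

Lemma steep_climb f x c : lipschitz1 f -> differentiable f x ->
  0 < enorm (c - x) -> f c = f x + enorm (c - x) -> steep f x.
Proof.
move=> fL dfx r0 fc; exists ((enorm (c - x))^-1 *: (c - x)).
  by rewrite enormZ gtr0_norm ?invr_gt0 // mulVf // gt_eqF.
apply: (derive_ray fL dfx r0).
  by rewrite enormZ gtr0_norm ?invr_gt0 // mulVf // gt_eqF.
by rewrite scalerA divff ?gt_eqF // scale1r addrC subrK.
Qed.

(** Restricting the steepness to points at least as high as x makes the lemma
applicable from inside D before the slope at the boundary is known. The point
c comes from compactness: the maximum of f over the ball is at least
f x + s - e for every e > 0. *)
Lemma climb f x s : lipschitz1 f -> 0 <= s ->
  (forall z, enorm (z - x) <= s -> f x <= f z ->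
    differentiable f z /\ steep f z) ->
  exists2 c, enorm (c - x) = s & f c = f x + s.
Proof.
move=> fL s0 fS; pose B := [set y | enorm (y - x) <= s].
have Bx : B x by rewrite /B /= subrr enorm0.
have [c /set_mem Bc cmax] : exists2 c, c \in B & forall t, t \in B -> f t <= f c.
  apply: EVT_max_rV; [by exists x|exact: compact_eball|].
  exact/continuous_subspaceT/lipschitz1_continuous.
suff fc : f x + s <= f c.
  have cs : enorm (c - x) = s.
    by apply/eqP; rewrite eq_le Bc /=; have := fL c x; lra.
  by exists c => //; apply/eqP; rewrite eq_le fc andbT; have := fL c x; lra.
(* The slope deficit q is chosen with q <= 1 and q * s <= e. *)
apply/ler_addgt0Pr => e e0.
pose q := e / (e + s + 1).
have q0 : 0 < q by apply: divr_gt0 => //; lra.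
have q1 : q <= 1 by rewrite ler_pdivrMr; lra.
have qs : q * s <= e.
  by rewrite mulrAC ler_pdivrMr ?ler_pM2l; lra.
pose g := fun y => f y - (1 - q) * enorm (y - x).
have [b /set_mem Bb bmax] : exists2 b, b \in B & forall t, t \in B -> g t <= g b.
  apply: EVT_max_rV; [by exists x|exact: compact_eball|].
  apply: continuous_subspaceT => y.
apply: (@continuousB _ _ _ f); first exact: (lipschitz1_continuous fL).
  apply: (@continuousM _ _ (fun=> 1 - q)); first exact: cst_continuous.
  exact: (lipschitz1_continuous (lipschitz1_enorm x)).
have := cmax b (mem_set Bb); have := bmax x (mem_set Bx).
rewrite /g subrr enorm0 mulr0 subr0 => gb fbc.
move: (Bb); rewrite /B /= le_eqVlt => /orP[/eqP bs|bs].
  by move: gb; rewrite bs; lra.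
have bx0 := enorm_ge0 (b - x).
have [dfb [u u1 fu]] : differentiable f b /\ steep f b.
  by apply: fS => //; nra.
(* An interior maximiser b of g has slope at most 1 - q in every direction. *)
suff : 'D_u f b <= 1 - q by lra.
have sb0 : 0 < s - enorm (b - x) by lra.
apply: (derive_le dfb sb0) => h h0 hs.
have bh : enorm (b + h *: u - x) <= enorm (b - x) + h.
  by rewrite addrAC (le_trans (enormD _ _)) // enormZ u1 mulr1 gtr0_norm.
have /mem_set/bmax : B (b + h *: u) by rewrite /B /=; lra.
rewrite /g; nra.
Qed.

(** Climbing f and - f gives a point a that is r higher and a point b that is r
lower than x. They are at distance at least 2 r from each other and both at
distance r from x, so strict convexity of the Euclidean norm makes them
antipodal. *)
Lemma two_sided_ray f x r : lipschitz1 f -> 0 < r ->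
  (forall z, enorm (z - x) <= r -> differentiable f z /\ steep f z) ->
  exists v, [/\ enorm v = 1, f (x + r *: v) = f x + r & f (x - r *: v) = f x - r].
Proof.
move=> fL r0 fS.
have [a ar fa] : exists2 c, enorm (c - x) = r & f c = f x + r.
  by apply: climb => // [|z zr _]; [exact: ltW|exact: fS].
have [b br fb] : exists2 c, enorm (c - x) = r & - f c = - f x + r.
  apply: (climb (f := fun y => - f y)); [exact: lipschitz1N|exact: ltW|].
  move=> z zr _; have [dfz Sz] := fS z zr.
  by split; [exact: differentiableN|exact/steepN].
have ab : (a - x) + (b - x) = 0.
  apply: enorm0_eq0; apply/eqP; rewrite -sqrf_eq0 eq_le sqr_ge0 andbT.
  have : (2 * r) ^+ 2 <= enorm (a - b) ^+ 2.
    by rewrite ler_pXn2r ?nnegrE ?enorm_ge0 //; have := fL a b; lra.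
  have -> : a - b = (a - x) - (b - x) by rewrite opprB addrA subrK.
  move: (a - x) (b - x) ar br => s t sr tr.
  rewrite !sqr_enorm !dotE -!sqr_enorm sr tr (dotC t s); lra.
have rr : r != 0 by rewrite gt_eqF.
exists (r^-1 *: (a - x)); rewrite scalerA divff // scale1r; split.
- by rewrite enormZ ar gtr0_norm ?invr_gt0 // mulVf.
- by rewrite addrC subrK.
- move/eqP: ab; rewrite addr_eq0 => /eqP ->; rewrite opprK addrC subrK; lra.
Qed.

(** The gradient has norm at most 1 and scalar product at least 1 with the unit
vector v, so it is v. *)
Lemma gradient_ray f x v r : lipschitz1 f -> differentiable f x ->
  0 < r -> enorm v = 1 -> f (x + r *: v) = f x + r -> gradient f x = v.
Proof.
move=> fL dfx r0 v1 fv; have := derive_ray fL dfx r0 v1 fv.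
have := derive_le_enorm (gradient f x) fL dfx.
rewrite !derive_gradient // -sqr_enorm => gg gv.
have g0 := enorm_ge0 (gradient f x).
apply/eqP; rewrite -subr_eq0; apply/eqP/enorm0_eq0/eqP.
rewrite -sqrf_eq0 eq_le sqr_ge0 andbT.
rewrite sqr_enorm !dotE -!sqr_enorm v1 (dotC v); nra.
Qed.

(** Put w = x - y and t = f x - f y. From the top of one ray to the bottom of the
other, 2 r + t <= |r (u + v) + w| and 2 r - t <= |r (u + v) - w|. Squaring
and adding, 8 r^2 + 2 t^2 <= 2 r^2 |u + v|^2 + 2 |w|^2, and
|u + v|^2 = 4 - |u - v|^2. *)
Lemma ray_directions_lipschitz f x y u v r : lipschitz1 f -> 0 < r ->
  enorm u = 1 -> enorm v = 1 ->
  f (x + r *: u) = f x + r -> f (x - r *: u) = f x - r ->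
  f (y + r *: v) = f y + r -> f (y - r *: v) = f y - r ->
  enorm (u - v) <= r^-1 * enorm (x - y).
Proof.
move=> fL r0 u1 v1 fxu fxu' fyv fyv'; rewrite ler_pdivlMl //.
have xy0 := enorm_ge0 (x - y); have uv0 := enorm_ge0 (u - v).
(* Squaring needs 2 r - |t| to be nonnegative; far apart points are trivial. *)
have [xy2|xy2] := leP (2 * r) (enorm (x - y)).
  apply: le_trans xy2; rewrite mulrC ler_pM2r //.
  by rewrite (le_trans (enormD _ _)) // enormN u1 v1; lra.
rewrite -(ler_pXn2r (n := 2)) ?nnegrE ?mulr_ge0 ?(ltW r0) // exprMn.
have fxy := fL x y; have fyx := fL y x; rewrite enormC in fyx.
have h1 : (2 * r + (f x - f y)) ^+ 2 <= enorm (r *: (u + v) + (x - y)) ^+ 2.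
  rewrite ler_pXn2r ?nnegrE ?enorm_ge0 //; last lra.
  have := fL (x + r *: u) (y - r *: v); rewrite fxu fyv'.
  have -> : x + r *: u - (y - r *: v) = r *: (u + v) + (x - y).
    by rewrite scalerDr opprB (addrC x) addrACA; congr (_ + _); rewrite addrC.
  lra.
have h2 : (2 * r - (f x - f y)) ^+ 2 <= enorm (r *: (u + v) - (x - y)) ^+ 2.
  rewrite ler_pXn2r ?nnegrE ?enorm_ge0 //; last lra.
  have := fL (y + r *: v) (x - r *: u); rewrite fyv fxu'.
  have -> : y + r *: v - (x - r *: u) = r *: (u + v) - (x - y).
    by rewrite scalerDr !opprB (addrC y) addrACA; congr (_ + _); rewrite addrC.
  lra.
move: h1 h2; move: (x - y) => w; rewrite !sqr_enorm !dotE -!sqr_enorm u1 v1.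
rewrite (dotC v u) (dotC u w) (dotC v w).
have := sqr_ge0 (f x - f y); lra.
Qed.

End Climbing.

(** * The signed distance function *)

Section SignedDistance.
Variables (R : realType) (m : nat) (D : set 'rV[R]_m).
Implicit Types (x y z w p : 'rV[R]_m).

Lemma boundary_dist_le x y : boundary D y -> boundary_dist D x <= enorm (x - y).
Proof.
move=> Dy; apply: ge_inf; last by exists y.
by exists 0 => _ [z _ <-]; exact: enorm_ge0.
Qed.

Lemma boundary_dist_attained p x : boundary D p ->
  exists2 y, boundary D y & boundary_dist D x = enorm (x - y).
Proof.
move=> Dp; pose K := [set y | enorm (y - x) <= enorm (p - x)] `&` boundary D.
have cK : compact K.
  apply: compact_closedI; first exact: compact_eball.
  by apply: closedI; [exact: closed_closure|exact/open_closedC/open_interior].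
have [y /set_mem [yp Dy] ymin] : exists2 c, c \in K &
    forall t, t \in K -> enorm (c - x) <= enorm (t - x).
  apply: EVT_min_rV => //; first by exists p; split => /=.
  apply: continuous_subspaceT.
  exact: (lipschitz1_continuous (lipschitz1_enorm x)).
exists y => //; apply/eqP; rewrite eq_le boundary_dist_le //=.
apply: lb_le_inf; first by exists (enorm (x - p)), p.
move=> _ [z Dz <-]; rewrite enormC (enormC x).
have [zp|/ltW pz] := leP (enorm (z - x)) (enorm (p - x)).
  by apply: ymin; apply/mem_set; split.
exact: le_trans pz.
Qed.

Lemma boundary_dist_ge0 p x : boundary D p -> 0 <= boundary_dist D x.
Proof.
by move=> /(boundary_dist_attained x)[y _ ->]; exact: enorm_ge0.
Qed.

Lemma boundary_dist_lipschitz1 p : boundary D p -> lipschitz1 (boundary_dist D).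
Proof.
move=> Dp x y; have [z Dz ->] := boundary_dist_attained y Dp.
by rewrite lerBlDr (le_trans (boundary_dist_le x Dz)) // enorm_tri.
Qed.

Lemma normr_signed_dist p x : boundary D p ->
  `|signed_dist D x| = boundary_dist D x.
Proof.
move=> /(boundary_dist_ge0 x) b0; rewrite /signed_dist.
by case: (x \in D); [|rewrite normrN]; exact: ger0_norm.
Qed.

Lemma signed_dist_boundary p : boundary D p -> signed_dist D p = 0.
Proof.
move=> Dp; apply/eqP; rewrite -normr_eq0 (normr_signed_dist p Dp) eq_le.
rewrite (boundary_dist_ge0 p Dp) andbT -(enorm0 R m) -(subrr p).
exact: boundary_dist_le.
Qed.

(** Otherwise, on the segment, the interior of D and the closure of D cut out the
same set, which is open, closed and nonempty; by connectedness it is the whole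
segment, so that y lies in D. *)
Lemma segment_crosses_boundary x y : D x -> ~ D y ->
  exists2 w, boundary D w & enorm (x - w) + enorm (w - y) = enorm (x - y).
Proof.
move=> Dx Dy; apply: contrapT => noW.
pose g (t : R) := x + t *: (y - x).
pose A := g @` `[0, 1].
have An w : A w -> ~ boundary D w.
  move=> [t /= /andP[]]; rewrite !bnd_simp => t0 t1 <- bw.
  apply: noW; exists (g t) => //.
  have -> : x - g t = t *: (x - y).
    by rewrite /g opprD addrA subrr add0r -scalerN opprB.
  have -> : g t - y = (1 - t) *: (x - y).
    by rewrite /g scalerBl scale1r -(opprB x y) scalerN addrAC.
  by rewrite !enormZ !ger0_norm ?subr_ge0 // -mulrDl addrC subrK mul1r.
have cA : connected A.
  apply: connected_continuous_connected; first exact: segment_connected.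
  apply: continuous_subspaceT => t.
  exact: differentiable_continuous.
have Ax : A x by exists 0; rewrite /= ?in_itv /= ?lexx ?ler01 // /g scale0r addr0.
have Ay : A y.
  by exists 1; rewrite /= ?in_itv /= ?lexx ?ler01 // /g scale1r addrC subrK.
have ADE : A `&` D° = A `&` closure D.
  apply/seteqP; split=> w [Aw Dw]; split=> //.
    by apply: subset_closure; exact: interior_subset.
  by apply: contrapT => nDw; apply: (An w Aw).
have /seteqP[_ /(_ y Ay)[_ /interior_subset]] // : A `&` D° = A.
apply: cA.
- by exists x; rewrite ADE; split => //; exact: subset_closure.
- by exists D° => //; exact: open_interior.
- by exists (closure D) => //; exact: closed_closure.
Qed.

(** Across the boundary, the two distances add up; a boundary point on the
segment from x to y bounds their sum. *)
Lemma signed_dist_lipschitz1 p : boundary D p -> lipschitz1 (signed_dist D).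
Proof.
move=> Dp x y; have bL := boundary_dist_lipschitz1 Dp.
have bx := boundary_dist_ge0 x Dp; have by_ := boundary_dist_ge0 y Dp.
have xy0 := enorm_ge0 (x - y).
rewrite /signed_dist; case: (asboolP (D x)) => Dx; case: (asboolP (D y)) => Dy.
- by rewrite !mem_set.
- rewrite (mem_set Dx) (memNset Dy).
  have [w Dw <-] := segment_crosses_boundary Dx Dy.
  by rewrite opprK lerD ?boundary_dist_le // enormC boundary_dist_le.
- by rewrite (memNset Dx) (mem_set Dy); lra.
- by rewrite !memNset //; have := bL y x; rewrite enormC; lra.
Qed.

(** The signed distance vanishes at a nearest boundary point y, so a point x
outside D climbs towards y, and - signed_dist climbs towards y from a point x
of D. *)
Lemma steep_off_boundary p x : boundary D p ->
  differentiable (signed_dist D) x -> signed_dist D x != 0 ->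
  steep (signed_dist D) x.
Proof.
move=> Dp ddx dx0; have dL := signed_dist_lipschitz1 Dp.
have [y Dy bxy] := boundary_dist_attained x Dp.
have dy0 := signed_dist_boundary Dy.
have nd := normr_signed_dist x Dp; rewrite bxy enormC in nd.
have yx0 : 0 < enorm (y - x) by rewrite -nd normr_gt0.
have [dx|dx|/eqP] := ltrgtP (signed_dist D x) 0; last by rewrite (negbTE dx0).
- by apply: (steep_climb dL ddx yx0); rewrite dy0 -nd ltr0_norm // subrr.
- have dNx : differentiable (fun z => - signed_dist D z) x := differentiableN ddx.
  apply/(steepN ddx)/(steep_climb (lipschitz1N dL) dNx yx0).
  by rewrite dy0 -nd gtr0_norm // oppr0 addNr.
Qed.

Lemma signed_dist_gt0 p x : open D -> boundary D p -> D x -> 0 < signed_dist D x.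
Proof.
move=> oD Dp Dx; rewrite /signed_dist (mem_set Dx).
have [y Dy ->] := boundary_dist_attained x Dp.
rewrite lt_neqAle enorm_ge0 andbT eq_sym; apply/eqP => /enorm0_eq0 /eqP.
by rewrite subr_eq0 => /eqP xy; case: Dy => _; rewrite -xy; apply; exact: open_nbhs_nbhs.
Qed.

(** Points x of D arbitrarily close to p can climb a height r - q, where q bounds
|x - p|, inside the ball around p: from there on the signed distance stays
positive and only steepness off the boundary is required. Hence the signed
distance reaches r, its largest conceivable value, on the ball. *)
Lemma steep_at_boundary p r : open D -> boundary D p -> 0 < r ->
  (forall z, enorm (z - p) <= r -> differentiable (signed_dist D) z) ->
  steep (signed_dist D) p.
Proof.
move=> oD Dp r0 ddU; have dL := signed_dist_lipschitz1 Dp.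
have d0 := signed_dist_boundary Dp.
pose B := [set y | enorm (y - p) <= r].
have [c /set_mem Bc cmax] :
    exists2 c, c \in B & forall t, t \in B -> signed_dist D t <= signed_dist D c.
  apply: EVT_max_rV; last exact/continuous_subspaceT/lipschitz1_continuous.
    by exists p; rewrite /B /= subrr enorm0 ltW.
  exact: compact_eball.
have rc : r <= signed_dist D c.
  apply/ler_addgt0Pr => e e0; pose q := Num.min (r / 2) (e / 2).
  have q0 : 0 < q by rewrite lt_min !divr_gt0.
  have qr : q <= r / 2 by rewrite ge_min lexx.
  have qe : q <= e / 2 by rewrite ge_min lexx orbT.
  have [x [Dx /= xp]] : D `&` [set y | enorm (y - p) <= q] !=set0.
    by apply: Dp.1; apply/nbhs_eball; exists q.
  have [|z zr dz|b bx db] := @climb _ _ _ x (r - q) dL; first by lra.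
    split; first by apply: ddU; have := enorm_tri x z p; lra.
    apply: (steep_off_boundary Dp).
      by apply: ddU; have := enorm_tri x z p; lra.
    by rewrite gt_eqF // (lt_le_trans (signed_dist_gt0 oD Dp Dx)).
  have /mem_set/cmax : B b by rewrite /B /=; have := enorm_tri x b p; lra.
  have := signed_dist_gt0 oD Dp Dx; lra.
have cr : enorm (c - p) = r.
  by apply/eqP; rewrite eq_le Bc /=; have := dL c p; rewrite d0; lra.
have ddp : differentiable (signed_dist D) p.
  by apply: ddU; rewrite subrr enorm0 ltW.
apply: (steep_climb (c := c) dL ddp); rewrite cr // d0 add0r.
by apply/eqP; rewrite eq_le rc andbT; have := dL c p; rewrite d0 cr; lra.
Qed.

Lemma steep_signed_dist p U : open D -> boundary D p -> open U ->
  (forall x, U x -> differentiable (signed_dist D) x) ->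
  forall x, U x -> steep (signed_dist D) x.
Proof.
move=> oD Dp oU ddU x Ux.
have [dx0|] := eqVneq (signed_dist D x) 0; last first.
  by apply: (steep_off_boundary Dp); exact: ddU.
have [y Dy bxy] := boundary_dist_attained x Dp.
have /enorm0_eq0/eqP : enorm (x - y) = 0.
  by rewrite -bxy -(normr_signed_dist x Dp) dx0 normr0.
rewrite subr_eq0 => /eqP xy; rewrite -{}xy in Dy.
have /nbhs_eball[e e0 eU] := open_nbhs_nbhs (conj oU Ux).
by apply: (steep_at_boundary oD Dy e0) => z /eU/ddU.
Qed.

End SignedDistance.

(** * Regularity of the signed distance *)

Theorem corollary6 (R : realType) (m : nat) (hm : (2 <= m)%N)
    (D : set 'rV[R]_m) (hD : is_domain D) (hDT : D `<` [set: 'rV[R]_m])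
    (p : 'rV[R]_m) (hp : boundary D p)
    (U : set 'rV[R]_m) (hU : open_nbhs p U)
    (hdiff : forall x, U x -> differentiable (signed_dist D) x) :
  C11_on U (signed_dist D).
Proof.
have [_ oD _] := hD; have [oU _] := hU.
have dL := signed_dist_lipschitz1 hp.
have dS := steep_signed_dist oD hp oU hdiff.
split=> // x Ux; have /nbhs_eball[e e0 eU] := open_nbhs_nbhs (conj oU Ux).
have r0 : 0 < e / 2 by rewrite divr_gt0.
(* Half of the radius e keeps the rays through all points near x inside U. *)
have ray y : enorm (y - x) <= e / 2 -> exists v, [/\ enorm v = 1,
    signed_dist D (y + (e / 2) *: v) = signed_dist D y + e / 2,
    signed_dist D (y - (e / 2) *: v) = signed_dist D y - e / 2 &
    gradient (signed_dist D) y = v].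
  move=> yx; have BU z : enorm (z - y) <= e / 2 -> U z.
    by move=> zy; apply: eU; have := enorm_tri y z x; lra.
  have [v [v1 fv fv']] : exists v, [/\ enorm v = 1,
      signed_dist D (y + (e / 2) *: v) = signed_dist D y + e / 2 &
      signed_dist D (y - (e / 2) *: v) = signed_dist D y - e / 2].
    by apply: two_sided_ray => // z /BU Uz; split; [exact: hdiff|exact: dS].
  exists v; split=> //; apply: (gradient_ray dL _ r0 v1 fv).
  by apply/hdiff/BU; rewrite subrr enorm0 ltW.
exists [set y | enorm (y - x) <= e / 2], (e / 2)^-1; split.
- by apply/nbhs_eball; exists (e / 2).
- by move=> y /= yx; apply: eU; lra.
- move=> y z /ray[v [v1 fv fv' ->]] /ray[w [w1 fw fw' ->]].
  exact: ray_directions_lipschitz fv fv' fw fw'.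
Qed.
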